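(* Let $R$ be a commutative ring with non-zero identity and let $M$ be a non-zero $R$-module which is either kernel-direct or image-direct. Let $S=\mathrm{End}_R(M)$ and, for $a\in R$, let $\varphi_a\in S$ be multiplication by $a$. Then the following statements are equivalent: (1) $\varphi_a$ is a regular element of $S$ for every $a\in R$; (2) $M=Ma\oplus \mathrm{Ann}_M(a)$ (internal direct sum) for every $a\in R$; (3) $Ma$ and $\mathrm{Ann}_M(a)$ are direct summands of $M$ for every $a\in R$; (4) $M$ is a weakly-morphic module.
   Context: All modules are unital (right) modules. For $a\in R$: $\varphi_a(m)=ma$, $Ma=\varphi_a(M)$, and $\mathrm{Ann}_M(a)=\{m\in M: ma=0\}=\ker(\varphi_a)$. An element $\varphi\in S$ is regular if there is $\psi\in S$ with $\varphi=\varphi\psi\varphi$. $M$ is kernel-direct if $\ker(\varphi)$ is a direct summand of $M$ for every $\varphi\in S$; $M$ is image-direct if $\varphi(M)$ is a direct summand of $M$ for every $\varphi\in S$. $M$ is weakly-morphic if $M/Ma\cong \mathrm{Ann}_M(a)$ as $R$-modules for every $a\in R$. *)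

(* Defs.v *)
From HB Require Import structures.
From mathcomp Require Import all_boot all_algebra.
From mathcomp Require Import boolp.

Set Implicit Arguments.
Unset Strict Implicit.
Unset Printing Implicit Defensive.

Import GRing.Theory Quotient.

Local Open Scope ring_scope.
Local Open Scope quotient_scope.

Section SubmoduleType.
Variables (R : pzRingType) (V : lmodType R) (N : submodClosed V).

Record submodType : predArgType :=
  Submod { submod_val :> V; _ : submod_val \in N }.

HB.instance Definition _ := [isSub for submod_val].
HB.instance Definition _ := [Choice of submodType by <:].
HB.instance Definition _ := [SubChoice_isSubLmodule of submodType by <:].

End SubmoduleType.

Section QuotientModule.
Variables (R : pzRingType) (V : lmodType R) (N : submodClosed V).

(* [submodClosed] does not record closure under opposites, which [{quot _}]
   requires; [submod_pred] is [N] equipped with it. *)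
Definition submod_pred : {pred V} := N.

Fact submod_pred_closed : submod_closed submod_pred.
Proof. exact: submodClosedP. Qed.

HB.instance Definition _ :=
  GRing.isSubmodClosed.Build R V submod_pred
    (GRing.submod_closed_semi submod_pred_closed).

Definition quotmod : Type := {quot submod_pred}.

HB.instance Definition _ := GRing.Zmodule.on quotmod.
HB.instance Definition _ : EqQuotient V (equiv submod_pred) quotmod :=
  EqQuotient.on quotmod.
HB.instance Definition _ := ZmodQuotient.on quotmod.

Definition quotmod_scale (a : R) (x : quotmod) : quotmod :=
  \pi_quotmod (a *: repr x).

Lemma quotmod_pi_scale a v :
  quotmod_scale a (\pi_quotmod v) = \pi_quotmod (a *: v).
Proof.
apply/eqP; rewrite -[_ == _]idealrBE -scalerBr rpredZ //.
by rewrite idealrBE reprK.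
Qed.

Lemma quotmod_scaleA a b x :
  quotmod_scale a (quotmod_scale b x) = quotmod_scale (a * b) x.
Proof.
by elim/quotW: x => v; rewrite (quotmod_pi_scale b) !quotmod_pi_scale scalerA.
Qed.

Lemma quotmod_scale1 : left_id 1 quotmod_scale.
Proof. by elim/quotW=> v; rewrite quotmod_pi_scale scale1r. Qed.

Lemma quotmod_scaleDr : right_distributive quotmod_scale +%R.
Proof.
move=> a; elim/quotW=> u; elim/quotW=> v.
by rewrite -raddfD !quotmod_pi_scale scalerDr raddfD.
Qed.

Lemma quotmod_scaleDl x : {morph quotmod_scale^~ x : a b / a + b}.
Proof.
by elim/quotW: x => v a b; rewrite !quotmod_pi_scale scalerDl raddfD.
Qed.

HB.instance Definition _ := GRing.Zmodule_isLmodule.Build R quotmod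
  quotmod_scaleA quotmod_scale1 quotmod_scaleDr quotmod_scaleDl.

Fact quotmod_pi_is_scalable : scalable (\pi_quotmod : V -> quotmod).
Proof. by move=> a v; exact: esym (quotmod_pi_scale a v). Qed.

HB.instance Definition _ :=
  GRing.isScalable.Build R V quotmod *:%R \pi_quotmod quotmod_pi_is_scalable.

End QuotientModule.

Section KernelImage.
Variables (R : pzRingType) (U V : lmodType R) (f : {linear U -> V}).

Definition lkernel : {pred U} := fun u => f u == 0.

Definition limage : {pred V} := fun v => `[< exists u, v = f u >].

Lemma lkernel_submod_closed : subsemimod_closed lkernel.
Proof.
split; first split; rewrite /lkernel.
- by rewrite unfold_in linear0.
- by move=> x y; rewrite !unfold_in linearD => /eqP-> /eqP->; rewrite addr0.
- by move=> a x; rewrite !unfold_in linearZ_LR => /eqP->; rewrite scaler0.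
Qed.

Lemma limage_submod_closed : subsemimod_closed limage.
Proof.
split; first split.
- by apply/asboolP; exists 0; rewrite linear0.
- move=> x y /asboolP[u ->] /asboolP[v ->].
  by apply/asboolP; exists (u + v); rewrite linearD.
- move=> a x /asboolP[u ->].
  by apply/asboolP; exists (a *: u); rewrite linearZ_LR.
Qed.

HB.instance Definition _ :=
  GRing.isSubmodClosed.Build R U lkernel lkernel_submod_closed.
HB.instance Definition _ :=
  GRing.isSubmodClosed.Build R V limage limage_submod_closed.

End KernelImage.

Definition isomorphic (R : pzRingType) (U V : lmodType R) : Prop :=
  exists f : {linear U -> V}, bijective f.

Section DirectSums.
Variables (R : pzRingType) (M : lmodType R).

Definition internal_direct_sum (A B : submodClosed M) : Prop :=
  (forall m : M, exists x y, [/\ x \in A, y \in B & m = x + y]) /\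
  (forall m : M, m \in A -> m \in B -> m = 0).

Definition direct_summand (A : submodClosed M) : Prop :=
  exists B : submodClosed M, internal_direct_sum A B.

Definition regular_endo (f : {linear M -> M}) : Prop :=
  exists g : {linear M -> M}, f =1 f \o g \o f.

Definition kernel_direct : Prop :=
  forall f : {linear M -> M}, direct_summand (lkernel f).

Definition image_direct : Prop :=
  forall f : {linear M -> M}, direct_summand (limage f).

End DirectSums.

Arguments kernel_direct {R} M.
Arguments image_direct {R} M.

(* Over a commutative ring right and left modules coincide, with [m a] written
   [a *: m]. *)
Section Multiplication.
Variables (R : comNzRingType) (M : lmodType R).

Definition mul_endo (a : R) : {linear M -> M} := *:%R a.

Definition mul_image (a : R) : submodClosed M := limage (mul_endo a).

Definition annihilator (a : R) : submodClosed M := lkernel (mul_endo a).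

Definition weakly_morphic : Prop :=
  forall a : R, isomorphic (quotmod (mul_image a)) (submodType (annihilator a)).

End Multiplication.

Arguments mul_endo {R} M a.
Arguments mul_image {R} M a.
Arguments annihilator {R} M a.
Arguments weakly_morphic {R} M.

(* Main.v *)
Require Import Defs.
From HB Require Import structures.
From mathcomp Require Import all_boot all_algebra.
From mathcomp Require Import boolp.
Set Implicit Arguments.
Unset Strict Implicit.
Unset Printing Implicit Defensive.
Local Open Scope ring_scope.

Import GRing.Theory.

(** Everything is governed by one fact, valid over any ring: an endomorphism
    whose kernel and image are both direct summands is regular
    ([summands_regular]). Its restriction to a complement of the kernel is an
    isomorphism onto the image, and the inverse, extended by zero along a
    complement of the image, is a quasi-inverse.

    For multiplication by [a] over a commutative ring, a quasi-inverse [g]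
    commutes with [a] because it is linear, so [a m = a^2 g(m)] and
    [m = a g(m) + (m - a g(m))] splits [M] as [Ma + Ann(a)]; the sum is direct
    since [a^2 x = 0] forces [a x = g(a^2 x) = 0] ([regular_mul_direct_sum]).
    So regularity, the decomposition and the summand condition are equivalent
    for every module, and they make [M] weakly morphic, as the quotient by one
    term of a direct sum is the other term ([quotmod_direct_sum]).

    The kernel-direct or image-direct assumption serves to return from weak
    morphicity. An isomorphism from
    [M/Ma] to [Ann(a)], composed with the projection from [M] and the
    inclusion into [M], is an endomorphism with kernel [Ma] and image [Ann(a)]
    ([isomorphic_quotmod_endo]). Hence both submodules are kernels of
    endomorphisms (the other being the kernel of [a]), and both are images (the
    other being the image of [a]): either half of the assumption makes both of
    them direct summands. *)

(** Linear maps are obtained below from their graphs: a submodule of [U * V]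
    that projects onto [U] and meets [0 * V] trivially is the graph of one. *)
Lemma linear_of_graph (R : pzRingType) (U V : lmodType R)
    (G : U -> V -> Prop) :
    (forall a u v u' v', G u v -> G u' v' -> G (a *: u + u') (a *: v + v')) ->
    (forall u, exists v, G u v) ->
    (forall v, G 0 v -> v = 0) ->
  exists f : {linear U -> V}, forall u, G u (f u).
Proof.
move=> Glin Gtot G0.
have Guniq u v v' : G u v -> G u v' -> v = v'.
  move=> Guv Guv'; apply/eqP; rewrite -subr_eq0 addrC -scaleN1r; apply/eqP.
  by apply: G0; rewrite -(addNr u) -scaleN1r; apply: Glin.
pose f u := projT1 (cid (Gtot u)).
have fP u : G u (f u) by rewrite /f; case: cid.
have f_lin : linear f.
  by move=> a u u'; apply: Guniq (fP _) _; apply: Glin.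
pose fL := GRing.isLinear.Build R U V *:%R f f_lin.
by exists (HB.pack f fL : {linear U -> V}).
Qed.

Section Submodules.
Variables (R : pzRingType) (M : lmodType R).
Implicit Types A B : submodClosed M.

Lemma submodB A x y : x \in A -> y \in A -> x - y \in A.
Proof. exact: (rpredB (S := submod_pred A)). Qed.

Lemma submod_linear A a x y : x \in A -> y \in A -> a *: x + y \in A.
Proof. by move=> Ax Ay; rewrite rpredD // rpredZ. Qed.

Lemma quotmod_pi_eq0 A (m : M) : (\pi_(quotmod A) m == 0)%qT = (m \in A).
Proof.
rewrite -(raddf0 (\pi_(quotmod A) : M -> quotmod A))%qT.
by rewrite -[LHS]Quotient.idealrBE subr0.
Qed.

Lemma internal_direct_sumC A B :
  internal_direct_sum A B -> internal_direct_sum B A.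
Proof.
move=> [ABsum AB0]; split=> [m | m Bm Am]; last exact: AB0.
by have [x [y [Ax By ->]]] := ABsum m; exists y, x; rewrite addrC.
Qed.

Lemma eq_direct_summand A A' : A =i A' -> direct_summand A -> direct_summand A'.
Proof.
move=> eqA [B [ABsum AB0]]; exists B; split=> m.
  by have [x [y [Ax By ->]]] := ABsum m; exists x, y; rewrite -eqA.
by rewrite -eqA; apply: AB0.
Qed.

(** The map from [B] to the quotient by [A] is bijective; its inverse is read
    off the transposed graph. *)
Lemma quotmod_direct_sum A B :
  internal_direct_sum A B -> isomorphic (quotmod A) (submodType B).
Proof.
move=> [ABsum AB0].
pose incl (y : submodType B) : quotmod A := (\pi_(quotmod A) (val y))%qT.
have inclP a y z : incl (a *: y + z) = a *: incl y + incl z.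
  by rewrite /incl !linearP.
have incl0 y : incl y = 0 -> y = 0.
  move/eqP; rewrite quotmod_pi_eq0 => Ay.
  by apply: val_inj; rewrite raddf0; apply: AB0 Ay (valP y).
have [|q||f fP] := @linear_of_graph R (quotmod A) (submodType B)
                     (fun q y => incl y = q).
- by move=> a q y q' y' <- <-.
- elim/quotW: q => m; have [x [y [Ax By ->]]] := ABsum m.
  exists (Submod By); rewrite /incl raddfD /=.
  by move: Ax; rewrite -quotmod_pi_eq0 => /eqP->; rewrite add0r.
- exact: incl0.
exists f; exists incl => // y.
apply/eqP; rewrite -subr_eq0 addrC -scaleN1r; apply/eqP/incl0.
by rewrite inclP fP scaleN1r addNr.
Qed.

Lemma isomorphic_quotmod_endo A B :
    isomorphic (quotmod A) (submodType B) ->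
  exists h : {linear M -> M}, lkernel h =i A /\ limage h =i B.
Proof.
move=> [f [g fK gK]].
pose h : {linear M -> M} := (val \o (f \o \pi_(quotmod A)%qT)).
exists h; split=> m.
  rewrite unfold_in -quotmod_pi_eq0 /lkernel /=.
  rewrite -(raddf0 (val : submodType B -> M)) (inj_eq val_inj).
  by rewrite -(raddf0 f) (inj_eq (can_inj fK)).
apply/asboolP/idP=> [[u ->] | Bm]; first exact: valP.
have [u Du] : exists u, (\pi_(quotmod A) u)%qT = g (Submod Bm).
  by elim/quotW: (g _) => u; exists u.
by exists u; rewrite /= Du gK.
Qed.

Lemma summands_regular (f : {linear M -> M}) :
  direct_summand (limage f) -> direct_summand (lkernel f) -> regular_endo f.
Proof.
move=> [C [ICsum IC0]] [B [KBsum KB0]].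
have im u : f u \in (limage f : {pred M}) by apply/asboolP; exists u.
(* [g m] is the [b] in [B] whose image under [f] is the component of [m] in
   the image of [f]. *)
have [|m|b|g gP] := @linear_of_graph R M M
                      (fun m b => b \in B /\ m - f b \in C).
- move=> a u v u' v' [Bv Cv] [Bv' Cv']; split; first exact: submod_linear.
  by rewrite linearP opprD addrACA -scalerBr submod_linear.
- have [_ [c [/asboolP[u ->] Cc ->]]] := ICsum m.
  have [k [b [/eqP fk0 Bb ->]]] := KBsum u.
  by exists b; rewrite linearD fk0 add0r addrC addKr.
- rewrite sub0r -linearN => -[Bb Cfb]; apply: KB0 => //.
  by rewrite -[_ \in _]/(f b == 0) -oppr_eq0 -linearN (IC0 _ (im _) Cfb).
exists g => m; apply/eqP; rewrite -subr_eq0; apply/eqP.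
by apply: IC0; [apply: submodB; apply: im | case: (gP (f m))].
Qed.

End Submodules.

Lemma regular_mul_direct_sum (R : comNzRingType) (M : lmodType R) (a : R) :
  regular_endo (mul_endo M a) ->
  internal_direct_sum (mul_image M a) (annihilator M a).
Proof.
move=> [g gP]; have {}gP (m : M) : a *: m = a *: (a *: g m).
  by rewrite -[a *: g m]linearZ; apply: gP.
split=> [m | _ /asboolP[x ->] /eqP/= aax0].
  exists (a *: g m), (m - a *: g m); split; last by rewrite addrC subrK.
    by apply/asboolP; exists (g m).
  by apply/eqP; rewrite /= scalerBr -gP subrr.
by rewrite /= gP -2!(linearZ_LR g) aax0 linear0.
Qed.

Lemma weakly_morphic_summands (R : comNzRingType) (M : lmodType R) :
    kernel_direct M \/ image_direct M -> weakly_morphic M ->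
  forall a : R, direct_summand (mul_image M a) /\
                direct_summand (annihilator M a).
Proof.
move=> M_direct M_morphic a.
have [h [kerh imh]] := isomorphic_quotmod_endo (M_morphic a).
case: M_direct => direct; split; try exact: direct.
  exact: eq_direct_summand kerh (direct h).
exact: eq_direct_summand imh (direct h).
Qed.

Theorem theorem1 (R : comNzRingType) (M : lmodType R)
    (M_neq0 : exists m : M, m != 0)
    (M_direct : kernel_direct M \/ image_direct M) :
  [<-> forall a : R, regular_endo (mul_endo M a);
       forall a : R, internal_direct_sum (mul_image M a) (annihilator M a);
       forall a : R, direct_summand (mul_image M a) /\
                     direct_summand (annihilator M a);
       weakly_morphic M].
Proof.
have summands_reg a : direct_summand (mul_image M a) /\
    direct_summand (annihilator M a) -> regular_endo (mul_endo M a).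
  by case; apply: summands_regular.
tfae.
- by move=> reg a; apply: regular_mul_direct_sum.
- move=> sum a; split; first by exists (annihilator M a).
  by exists (mul_image M a); apply: internal_direct_sumC.
- move=> summ a; apply: quotmod_direct_sum.
  by apply: regular_mul_direct_sum; apply: summands_reg.
by move=> morphic a; apply/summands_reg/weakly_morphic_summands.
Qed.
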